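(* Let $p$ be a prime, $f(x)=\sum_{k=k_a}^{k_b}c_kx^k\in\mathbb{F}_p[x,x^{-1}]$ with $k_a<k_b$, $c_{k_a}\ne0$, $c_{k_b}\ne0$, $f(1)\neq0$; let $L_x=p^N$ with $N\ge1$, and let $L_y$ be a positive multiple of $L_x$ with $f(x)^{L_y}=1$ in $\mathbb{F}_p[x]/\langle x^{L_x}-1\rangle$. Let $l_x,l_y\ge0$ be integers with $2l_y+2\le L_y$, and let $\mathbf{W}_0\in\mathbb{F}_p^{L_x\times L_x}$ be consistently local, i.e. for all integers $j$ the matrix $\mathbf{W}_j:=\mathbf{F}^j\mathbf{W}_0\mathbf{F}^{-j}$ has nonzero $(i',i)$ entries only for $i'-i$ congruent modulo $L_x$ to an integer in $[-l_x+2l_yk_a,\,l_x+2l_yk_b]$. For $i\in\mathbb{Z}/L_x$, $j\in\mathbb{Z}/L_y$ define $$A_{ij}=X^{(a)}_j[\mathbf{e}_i]\,Z^{(b)}_{j+l_y}[-\mathbf{W}_j\mathbf{e}_i]\,Z^{(b)}_{j+l_y+1}[\mathbf{F}\mathbf{W}_j\mathbf{e}_i],$$ $$B_{ij}=X^{(b)}_{j+l_y}[\mathbf{e}_i]\,Z^{(a)}_{j}[-\mathbf{W}_j^T\mathbf{e}_i]\,Z^{(a)}_{j-1}[\mathbf{F}^T\mathbf{W}_j^T\mathbf{e}_i].$$ Then: 1. Every $A_{ij}$ and every $B_{ij}$ commutes with all symmetry operators $S(g^{(a,j_0)}[\mathbf{v}])$ and $S(g^{(b,j_0)}[\mathbf{v}])$,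 for all $j_0\in\mathbb{Z}/L_y$, $\mathbf{v}\in\mathbb{F}_p^{L_x}$. 2. The operators $\{A_{ij}\}\cup\{B_{ij}\}$ mutually commute. 3. There is a unique state $|\psi\rangle$ (up to scalar) with $A_{ij}|\psi\rangle=B_{ij}|\psi\rangle=|\psi\rangle$ for all $i,j$, and $S(g^{(\alpha,j_0)}[\mathbf{v}])|\psi\rangle=|\psi\rangle$ for all $\alpha\in\{a,b\}$, $j_0$, $\mathbf{v}$. 4. (Twist phases.) Let $i,i'\in\mathbb{Z}/L_x$, let $R$ be an integer with $0\le R\le L_y-l_y-2$, and let $S_{\ge}=\prod_{j=0}^{R}X^{(a)}_j[\mathbf{F}^{j}\mathbf{e}_i]$. Let $A'_{kj},B'_{kj}$ be obtained from $A_{kj},B_{kj}$ by conjugation $O\mapsto S_\ge O S_\ge^\dagger$ for those terms crossing the cut between rows $-1$ and $0$, namely $A_{kj}$ with $-l_y-1\le j\le -1$ and $B_{kj}$ with $-l_y\le j\le 0$ (row labels modulo $L_y$), and let all other terms be unchanged. Then there is a unique state $|\psi'\rangle$ (up to scalar) with $A'_{kj}|\psi'\rangle=B'_{kj}|\psi'\rangle=|\psi'\rangle$ for all $k,j$, and $$S(g^{(b,l_y)}[\mathbf{e}_{i'}])|\psi'\rangle=e^{\frac{2\pi i}{p}(\mathbf{W}_0)_{i'i}}|\psi'\rangle,$$ where in the exponent $2\pi i$ the symbol $i$ denotes the imaginary unit.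
   Context: Sites are $(i,j)\in\mathbb{Z}/L_x\times\mathbb{Z}/L_y$; ''row $j$'' is the set of sites with second coordinate $j$. On every site there are two $p$-dimensional degrees of freedom labelled $\alpha\in\{a,b\}$, with unitary operators $X^{(\alpha)}_{ij},Z^{(\alpha)}_{ij}$: $Z$ is diagonal with the $p$ distinct $p$-th roots of unity as eigenvalues, $X$ is the cyclic raising operator, $X^p=Z^p=1$, $XZ=e^{2\pi \mathrm{i}/p}ZX$ on the same site and same $\alpha$, and operators for different sites or different $\alpha$ commute. The total Hilbert space is the tensor product over all sites and $\alpha$. For $\mathbf{v}\in\mathbb{F}_p^{L_x}$, $X^{(\alpha)}_j[\mathbf{v}]=\prod_i(X^{(\alpha)}_{ij})^{v_i}$ and $Z^{(\alpha)}_j[\mathbf{v}]=\prod_i(Z^{(\alpha)}_{ij})^{v_i}$. $\mathbf{e}_i$ is the $i$-th standard unit vector. $\mathbf{F}\in\mathbb{F}_p^{L_x\times L_x}$ is the circulant matrix representing multiplication by $f(x)$ on $\mathbb{F}_p[x]/\langle x^{L_x}-1\rangle$, $F_{i'i}=\sum_{k\equiv i'-i\bmod L_x}c_k$; it is invertible and $\mathbf{F}^{L_y}=1$, so $\mathbf{W}_j$ depends only on $j$ mod $L_y$. The fractal symmetry operators are $S(g^{(a,j_0)}[\mathbf{v}])=\prod_{j\in\mathbb{Z}/L_y}X^{(a)}_j[\mathbf{F}^{j-j_0}\mathbf{v}]$ and $S(g^{(b,j_0)}[\mathbf{v}])=\prod_{j\in\mathbb{Z}/L_y}X^{(b)}_j[(\mathbf{F}^T)^{j_0-j}\mathbf{v}]$.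 *)

(* Defs.v *)
From HB Require Import structures.
From mathcomp Require Import all_boot all_order all_algebra.
From mathcomp Require Import complex.
From mathcomp Require Import reals trigo.

Set Implicit Arguments.
Unset Strict Implicit.
Unset Printing Implicit Defensive.

Import Order.TTheory GRing.Theory Num.Theory.

Local Open Scope ring_scope.
Local Open Scope complex_scope.
Local Open Scope sesquilinear_scope.

(* 'Z_L is definitionally 'I_(Zdim L), so a matrix of dimension Zdim L is      *)
(* indexed by 'Z_L. It is the integers mod L only for L > 1, and 'F_p is the   *)
(* field with p elements only for p prime.                                     *)
Notation Zdim L := ((Zp_trunc L).+2) (only parsing).

(* The integers k with lo <= k <= hi; empty if hi < lo. *)
Definition zrange (lo hi : int) : seq int :=
  [seq lo + m%:Z | m <- iota 0 `|(Num.max 0 (hi - lo + 1))%R|%N].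

Lemma mem_zrange (lo hi k : int) : (k \in zrange lo hi) = (lo <= k <= hi).
Proof.
apply/mapP/andP => [[m] | [lek ekh]].
  rewrite mem_iota add0n /= => lem ->; rewrite lerDl; split=> //.
  case: (leP 0 (hi - lo + 1)) lem => [le0 lem | //].
  by move: lem; rewrite -ltz_nat gez0_abs // ltzD1 lerBrDl.
exists `|k - lo|%N; last by rewrite gez0_abs ?subr_ge0 // subrKC.
rewrite mem_iota add0n /= -ltz_nat !gez0_abs ?subr_ge0 ?le_max ?lexx //.
by rewrite lt_max ltzD1 lerB ?orbT.
Qed.

(* x is the class modulo L of an integer of [lo, hi] *)
Definition in_window (L : nat) (lo hi : int) (x : 'Z_L) : bool :=
  has (fun d : int => d%:~R == x) (zrange lo hi).

(* Value at x of the Laurent polynomial \sum_(ka <= k <= kb) c_k x^k; x has to *)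
(* be a unit. The values of c outside [ka, kb] are irrelevant.                 *)
Definition laurent_eval (K : fieldType) (A : unitAlgType K)
    (c : int -> K) (ka kb : int) (x : A) : A :=
  \sum_(k <- zrange ka kb) c k *: x ^ k.

Definition circulantF (p L : nat) (c : int -> 'F_p) (ka kb : int) :
    'M['F_p]_(Zdim L) :=
  \matrix_(i' < Zdim L, i < Zdim L)
    \sum_(k <- zrange ka kb | (k%:~R : 'Z_L) == i' - i) c k.

Definition Wmx (p L : nat) (F W0 : 'M['F_p]_(Zdim L)) (j : int) :
    'M['F_p]_(Zdim L) :=
  F ^ j *m W0 *m F ^ (- j).

Definition consistently_local (p L : nat) (F W0 : 'M['F_p]_(Zdim L))
    (ka kb : int) (lx ly : nat) : Prop :=
  forall (j : int) (i' i : 'Z_L), Wmx F W0 j i' i != 0 ->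
    in_window (- lx%:Z + (2 * ly)%:Z * ka) (lx%:Z + (2 * ly)%:Z * kb) (i' - i).

Definition unitvec (p L : nat) (i : 'Z_L) : 'cV['F_p]_(Zdim L) :=
  delta_mx i 0.

Definition species := bool.
Definition spa : species := false.
Definition spb : species := true.

Definition dof (Lx Ly : nat) := ('Z_Lx * 'Z_Ly * species)%type.

(* Labels of the computational basis of the tensor product, over all degrees   *)
(* of freedom, of copies of the p-dimensional space with basis 'F_p.           *)
Definition config (p Lx Ly : nat) := {ffun dof Lx Ly -> 'F_p}.

Notation state R p Lx Ly := 'cV[R[i]]_#|{: config p Lx Ly}|.
Notation operator R p Lx Ly := 'M[R[i]]_#|{: config p Lx Ly}|.

(* exp(2 pi i / p) *)
Definition omega (R : realType) (p : nat) : R[i] :=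
  cos (2 * pi / p%:R) +i* sin (2 * pi / p%:R).

(* The exponent is the representative in [0, p); omega has order p. *)
Definition omegaX (R : realType) (p : nat) (x : 'F_p) : R[i] :=
  omega R p ^+ (x : nat).

(* X |s> = |s + 1> and Z |s> = omega^(-s) |s>: for a raising X, this sign in Z *)
(* is what gives X Z = omega Z X.                                              *)
Definition shiftX (R : realType) (p : nat) : 'M[R[i]]_(Zdim (pdiv p)) :=
  \matrix_(s, t) ((s : 'F_p) == (t : 'F_p) + 1)%:R.

Definition clockZ (R : realType) (p : nat) : 'M[R[i]]_(Zdim (pdiv p)) :=
  diag_mx (\row_s omegaX R (- (s : 'F_p))).

(* M acting on the tensor factor q, and the identity on all the others *)
Definition local_op (R : realType) (p Lx Ly : nat) (q : dof Lx Ly)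
    (M : 'M[R[i]]_(Zdim (pdiv p))) : operator R p Lx Ly :=
  \matrix_(s, t)
    let s' := enum_val s : config p Lx Ly in
    let t' := enum_val t : config p Lx Ly in
    if [forall q', (q' != q) ==> (s' q' == t' q')] then M (s' q) (t' q) else 0.

(* The operators of Xrow al j v commute with each other (and likewise for      *)
(* Zrow), so the order of the product is immaterial.                           *)
Definition Xrow (R : realType) (p Lx Ly : nat) (al : species) (j : 'Z_Ly)
    (v : 'cV['F_p]_(Zdim Lx)) : operator R p Lx Ly :=
  \prod_(i : 'Z_Lx) local_op (i, j, al) (shiftX R p) ^+ (v i 0 : nat).

Definition Zrow (R : realType) (p Lx Ly : nat) (al : species) (j : 'Z_Ly)
    (v : 'cV['F_p]_(Zdim Lx)) : operator R p Lx Ly :=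
  \prod_(i : 'Z_Lx) local_op (i, j, al) (clockZ R p) ^+ (v i 0 : nat).

(* For j : 'Z_Ly, (j : nat)%:Z is the representative of j in [0, Ly). The      *)
(* choice of representative is immaterial below because F ^ Ly = 1.            *)
Definition zrep (L : nat) (j : 'Z_L) : int := (j : nat)%:Z.

Definition symA (R : realType) (p Lx Ly : nat) (F : 'M['F_p]_(Zdim Lx))
    (j0 : 'Z_Ly) (v : 'cV['F_p]_(Zdim Lx)) : operator R p Lx Ly :=
  \prod_(j : 'Z_Ly) Xrow R spa j (F ^ (zrep j - zrep j0) *m v).

Definition symB (R : realType) (p Lx Ly : nat) (F : 'M['F_p]_(Zdim Lx))
    (j0 : 'Z_Ly) (v : 'cV['F_p]_(Zdim Lx)) : operator R p Lx Ly :=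
  \prod_(j : 'Z_Ly) Xrow R spb j (F^T ^ (zrep j0 - zrep j) *m v).

Definition termA (R : realType) (p Lx Ly : nat) (F W0 : 'M['F_p]_(Zdim Lx))
    (ly : nat) (i : 'Z_Lx) (j : 'Z_Ly) : operator R p Lx Ly :=
  let W := Wmx F W0 (zrep j) in
  Xrow R spa j (unitvec p i)
  * Zrow R spb (j + ly%:R) (- W *m unitvec p i)
  * Zrow R spb (j + ly%:R + 1) (F *m W *m unitvec p i).

Definition termB (R : realType) (p Lx Ly : nat) (F W0 : 'M['F_p]_(Zdim Lx))
    (ly : nat) (i : 'Z_Lx) (j : 'Z_Ly) : operator R p Lx Ly :=
  let W := Wmx F W0 (zrep j) in
  Xrow R spb (j + ly%:R) (unitvec p i)
  * Zrow R spa j (- W^T *m unitvec p i)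
  * Zrow R spa (j - 1) (F^T *m W^T *m unitvec p i).

Definition truncS (R : realType) (p Lx Ly : nat) (F : 'M['F_p]_(Zdim Lx))
    (i : 'Z_Lx) (r : nat) : operator R p Lx Ly :=
  \prod_(j < r.+1) Xrow R spa (j%:R : 'Z_Ly) (F ^+ j *m unitvec p i).

Definition conj_by (R : realType) (n : nat) (S O : 'M[R[i]]_n) : 'M[R[i]]_n :=
  S *m O *m S^t*.

(* The integer windows are the terms crossing the cut between rows -1 and 0.    *)
Definition twistA (R : realType) (p Lx Ly : nat) (F W0 : 'M['F_p]_(Zdim Lx))
    (ly : nat) (i : 'Z_Lx) (r : nat) (k : 'Z_Lx) (j : 'Z_Ly) :
    operator R p Lx Ly :=
  if in_window (- ly%:Z - 1) (-1) j
  then conj_by (truncS R Ly F i r) (termA R F W0 ly k j)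
  else termA R F W0 ly k j.

Definition twistB (R : realType) (p Lx Ly : nat) (F W0 : 'M['F_p]_(Zdim Lx))
    (ly : nat) (i : 'Z_Lx) (r : nat) (k : 'Z_Lx) (j : 'Z_Ly) :
    operator R p Lx Ly :=
  if in_window (- ly%:Z) 0 j
  then conj_by (truncS R Ly F i r) (termB R F W0 ly k j)
  else termB R F W0 ly k j.

Definition stabilized (R : realType) (p Lx Ly : nat)
    (A B : 'Z_Lx -> 'Z_Ly -> operator R p Lx Ly) (psi : state R p Lx Ly) :
    Prop :=
  forall i j, A i j *m psi = psi /\ B i j *m psi = psi.

(* psi spans the space of vectors that satisfy P *)
Definition unique_state (R : realType) (n : nat) (P : 'cV[R[i]]_n -> Prop)
    (psi : 'cV[R[i]]_n) : Prop :=
  [/\ psi != 0, P psi & forall phi, P phi -> exists a : R[i], phi = a *: psi].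

(* Main.v *)
Require Import Defs.
From mathcomp Require Import all_boot all_order all_algebra.
From mathcomp Require Import complex.
From mathcomp Require Import reals trigo.
From mathcomp Require Import zify ring.

(* Up to phases, every operator of the model is a Weyl operator X^u Z^w, with u *)
(* and w functions from the degrees of freedom to F_p, so commutation reduces  *)
(* to linear algebra over F_p and to W_{j+1} F = F W_j. The X parts of the     *)
(* terms A and B are exactly the elementary configurations, each occurring     *)
(* once: the stabilized state is a graph state, whose amplitudes are powers of *)
(* omega with explicit quadratic exponents and never vanish; this gives        *)
(* existence and uniqueness without counting independent stabilizers.          *)
(* Conjugation by the truncated symmetry multiplies B_{k0} by                  *)
(* omega^(- (W_0)_{ki}) and fixes every other term that crosses the cut, which *)
(* adds a linear term to the exponent; the symmetry of species b reads off     *)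
(* this term at row l_y.                                                       *)

Import Order.TTheory GRing.Theory Num.Theory.

Local Open Scope ring_scope.

(** By [weylM], [weyl u w] and [weyl u' w'] commute as soon as the symplectic form w.u' - w'.u
    vanishes. By [termA_weyl] and [termB_weyl] there is one term for each degree of freedom q: its X
    part is [unit_cfg p q] and its Z part is row q of a matrix [weight]. Mutual commutation is
    therefore the symmetry of this matrix ([weight_sym]). Commutation with an X-type symmetry is the
    orthogonality of its configuration to all rows ([weight_symA], [weight_symB]), which holds
    because consecutive rows of a fractal symmetry differ by F or its transpose. The equation of
    generator q fixes the ratio of the amplitudes at s + e_q and s. The matrix is symmetric and
    bipartite, so these ratios are consistent, and the solution is unique up to scalar
    ([graph_state_stab], [graph_state_unique]). A configuration tau orthogonal to all rows leaves
    the quadratic exponent invariant, so X^tau acts by omega^(- theta.tau), where theta collects the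
    phases of the generators ([graph_state_symmetry]). The ground state has theta = 0; the twisted
    one has theta = [twist_charge], computed in [twist_phase]. *)

Section WeylOperators.
Set Implicit Arguments.
Unset Strict Implicit.
Unset Printing Implicit Defensive.

Variables (R : realType) (p : nat).
Hypothesis p_prime : prime p.

Local Notation omegaX := (@omegaX R p).

(** * Powers of omega as an additive character of F_p *)

Lemma omega_exp n :
  omega R p ^+ n =
  Complex (cos (2 * pi / p%:R * n%:R)) (sin (2 * pi / p%:R * n%:R)).
Proof.
elim: n => [|n IHn]; first by rewrite expr0 mulr0 cos0 sin0.
rewrite exprS IHn /omega; set a := 2 * pi / p%:R.
have -> : a * n.+1%:R = a + a * n%:R by ring.
rewrite cosD sinD.
rewrite [LHS]/(_ * _) /=; congr Complex; ring.
Qed.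

Lemma omega_expp : omega R p ^+ p = 1.
Proof.
rewrite omega_exp mulfVK; last by rewrite pnatr_eq0 -lt0n prime_gt0.
by rewrite mulr_natl cos2pi sin2pi.
Qed.

Lemma omegaX0 : omegaX 0 = 1.
Proof. by rewrite /omegaX expr0. Qed.

Lemma omegaXD x y : omegaX (x + y) = omegaX x * omegaX y.
Proof.
rewrite /omegaX -exprD -(expr_mod (_ + _) omega_expp) /=.
(* Addition in ['F_p] reduces modulo a number that equals p only because p is prime. *)
by congr (_ ^+ (_ %% _)); exact: Fp_cast.
Qed.

Lemma omegaX_neq0 x : omegaX x != 0.
Proof.
apply/eqP => x0; have /eqP := omegaX0.
by rewrite -(subrr x) omegaXD x0 mul0r eq_sym oner_eq0.
Qed.

Lemma mulmx_inj n (M M' : 'M[R[i]]_n) :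
  (forall v : 'cV_n, M *m v = M' *m v) -> M = M'.
Proof.
move=> MM'; apply/matrixP => i j; have := MM' (delta_mx j 0).
by rewrite -!colE => /colP /(_ i); rewrite !mxE.
Qed.

(** * Weyl operators and graph states over an arbitrary finite set of degrees of freedom *)

Section Configurations.
Variable T : finType.
Local Notation cfg := {ffun T -> 'F_p}.
Local Notation op := 'M[R[i]]_#|{: cfg}|.
Implicit Types (u w s t : cfg) (g h : cfg -> R[i]).

Definition dot u w : 'F_p := \sum_q u q * w q.

Lemma dotC u w : dot u w = dot w u.
Proof. by apply: eq_bigr => q _; rewrite mulrC. Qed.

Lemma dot0l w : dot 0 w = 0.
Proof. by rewrite /dot big1 // => q _; rewrite ffunE mul0r. Qed.

Lemma dot0r w : dot w 0 = 0. Proof. by rewrite dotC dot0l. Qed.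

Lemma dotDl u1 u2 w : dot (u1 + u2) w = dot u1 w + dot u2 w.
Proof. by rewrite -big_split; apply: eq_bigr => q _; rewrite ffunE mulrDl. Qed.

Lemma dotDr u w1 w2 : dot u (w1 + w2) = dot u w1 + dot u w2.
Proof. by rewrite !(dotC u) dotDl. Qed.

Lemma dotNr u w : dot u (- w) = - dot u w.
Proof. by apply/eqP; rewrite -subr_eq0 opprK -dotDr addNr dot0r. Qed.

Lemma dotBr u w1 w2 : dot u (w1 - w2) = dot u w1 - dot u w2.
Proof. by rewrite dotDr dotNr. Qed.

Lemma dotMnr u w n : dot u (w *+ n) = dot u w *+ n.
Proof.
by elim: n => [|n IHn]; rewrite ?mulr0n ?dot0r // !mulrS dotDr IHn.
Qed.

Lemma dot_sumr (I : Type) (r : seq I) (P : pred I) (F : I -> cfg) u :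
  dot u (\sum_(i <- r | P i) F i) = \sum_(i <- r | P i) dot u (F i).
Proof. exact: (big_morph (dot u) (dotDr u) (dot0r u)). Qed.

Definition unit_cfg (q : T) : cfg := [ffun q' => (q' == q)%:R].

Lemma dot_unitr w q : dot w (unit_cfg q) = w q.
Proof.
rewrite /dot (bigD1 q) //= ffunE eqxx mulr1 big1 ?addr0 // => q' /negPf q'q.
by rewrite ffunE q'q mulr0.
Qed.

Lemma cfg_sum_unit s : s = \sum_q unit_cfg q *+ (s q : nat).
Proof.
apply/ffunP => q; rewrite sum_ffunE (bigD1 q) //= ffunMnE ffunE eqxx.
rewrite natr_Zp big1 ?addr0 // => q' /negPf qq'.
by rewrite ffunMnE ffunE eq_sym qq' mul0rn.
Qed.

Definition wave g : 'cV[R[i]]_#|{: cfg}| := \col_s g (enum_val s).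

Lemma eq_wave g h : g =1 h -> wave g = wave h.
Proof. by move=> gh; apply/colP => s; rewrite !mxE gh. Qed.

Lemma wave_inj g h : wave g = wave h -> g =1 h.
Proof.
by move=> /colP gh s; have := gh (enum_rank s); rewrite !mxE enum_rankK.
Qed.

Lemma waveP (phi : 'cV[R[i]]_#|{: cfg}|) : exists g, phi = wave g.
Proof.
exists (fun s => phi (enum_rank s) 0).
by apply/colP => s; rewrite mxE enum_valK.
Qed.

Lemma scale_wave a g : a *: wave g = wave (fun s => a * g s).
Proof. by apply/colP => s; rewrite !mxE. Qed.

Lemma op_eqP (M M' : op) : (forall g, M *m wave g = M' *m wave g) -> M = M'.
Proof.
move=> MM'; apply: mulmx_inj => v.
by have [g ->] := waveP v.
Qed.

(* X^u Z^w in the conventions of [shiftX] and [clockZ] *)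
Definition weyl u w : op :=
  \matrix_(s, t)
    if enum_val s == (enum_val t : cfg) + u
    then omegaX (- dot w (enum_val t)) else 0.

Lemma weyl_wave u w g :
  weyl u w *m wave g =
  wave (fun s => omegaX (- dot w (s - u)) * g (s - u)).
Proof.
apply/colP => s; rewrite !mxE (bigD1 (enum_rank (enum_val s - u))) //=.
rewrite !mxE enum_rankK subrK eqxx big1 ?addr0 // => t t_neq.
rewrite mxE -subr_eq; case: (_ =P enum_val t) => [def_t|_]; last by rewrite mul0r.
by rewrite def_t enum_valK eqxx in t_neq.
Qed.

(** Moving Z^w to the right past X^u' costs the phase omega^(- w.u'). *)
Lemma weylM u w u' w' :
  weyl u w * weyl u' w' = omegaX (- dot w u') *: weyl (u + u') (w + w').
Proof.
apply: op_eqP => g; rewrite -mulmxA weyl_wave weyl_wave.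
rewrite -scalemxAl weyl_wave scale_wave.
apply: eq_wave => s; rewrite mulrA -omegaXD mulrA -omegaXD.
rewrite opprD addrA; congr (omegaX _ * _).
rewrite dotDl !dotBr; ring.
Qed.

Lemma weyl00 : weyl 0 0 = 1.
Proof.
apply: op_eqP => g; rewrite weyl_wave mul1mx; apply: eq_wave => s.
by rewrite dot0l subr0 oppr0 omegaX0 mul1r.
Qed.

Lemma weyl_comm u w u' w' :
  dot w u' = dot w' u -> GRing.comm (weyl u w) (weyl u' w').
Proof. by move=> ww'; rewrite /GRing.comm !weylM ww' (addrC u) (addrC w). Qed.

Lemma weylXD u u' : weyl (u + u') 0 = weyl u 0 * weyl u' 0.
Proof. by rewrite weylM dot0l oppr0 omegaX0 scale1r addr0. Qed.

Lemma weylZD w w' : weyl 0 (w + w') = weyl 0 w * weyl 0 w'.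
Proof. by rewrite weylM dot0r oppr0 omegaX0 scale1r addr0. Qed.

Lemma weylXZ u w : weyl u 0 * weyl 0 w = weyl u w.
Proof. by rewrite weylM dot0r oppr0 omegaX0 scale1r addr0 add0r. Qed.

Lemma weylX_exp u n : weyl u 0 ^+ n = weyl (u *+ n) 0.
Proof.
elim: n => [|n IHn]; first by rewrite expr0 mulr0n weyl00.
by rewrite exprS mulrS weylXD IHn.
Qed.

Lemma weylZ_exp w n : weyl 0 w ^+ n = weyl 0 (w *+ n).
Proof.
elim: n => [|n IHn]; first by rewrite expr0 mulr0n weyl00.
by rewrite exprS mulrS weylZD IHn.
Qed.

Lemma weylX_prod (I : Type) (r : seq I) (P : pred I) (F : I -> cfg) :
  \prod_(i <- r | P i) weyl (F i) 0 = weyl (\sum_(i <- r | P i) F i) 0.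
Proof. exact/esym/(big_morph (fun u => weyl u 0) weylXD weyl00). Qed.

Lemma weylZ_prod (I : Type) (r : seq I) (P : pred I) (F : I -> cfg) :
  \prod_(i <- r | P i) weyl 0 (F i) = weyl 0 (\sum_(i <- r | P i) F i).
Proof. exact/esym/(big_morph (weyl 0) weylZD weyl00). Qed.

Lemma weylX_adj u : (weyl u 0)^t*%sesqui = weyl (- u) 0.
Proof.
apply/matrixP => s t; rewrite !mxE !dot0l oppr0 omegaX0.
rewrite [in RHS]eq_sym subr_eq.
by case: ifP => _; rewrite ?conjC1 ?conjC0.
Qed.

(** X^sg commutes with X^u, and passing it through Z^w costs a scalar; hence twisting a term by an X
    string changes only its phase. *)
Lemma weyl_conj sg u w :
  conj_by (weyl sg 0) (weyl u w) = omegaX (dot w sg) *: weyl u w.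
Proof.
rewrite /conj_by weylX_adj !mulmxE weylM dot0l oppr0 omegaX0 scale1r weylM.
rewrite add0r addr0 dotNr opprK.
by rewrite [sg + u]addrC addrK.
Qed.

(* Stabilizer generators whose X parts are the elementary configurations: the *)
(* wave function is determined by its value at 0, and bipartiteness of the    *)
(* weight matrix m makes it the phase of an F_p-quadratic form also for p = 2. *)
Section GraphState.
Variables (side : T -> bool) (m : T -> cfg) (theta : cfg).
Hypothesis m_sym : forall q q', m q q' = m q' q.
Hypothesis m_bip : forall q q', side q = side q' -> m q q' = 0.

Definition graph_gen (q : T) : op :=
  omegaX (theta q) *: weyl (unit_cfg q) (m q).

(** Half of the bilinear form s^T m t: on the diagonal, summing over one side only replaces division
    by 2. *)
Definition graph_form s t : 'F_p := \sum_(q | side q) s q * dot (m q) t.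

Definition graph_state : 'cV[R[i]]_#|{: cfg}| :=
  wave (fun s => omegaX (dot theta s - graph_form s s)).

Lemma graph_formDl s1 s2 t :
  graph_form (s1 + s2) t = graph_form s1 t + graph_form s2 t.
Proof.
by rewrite -big_split; apply: eq_bigr => q _; rewrite ffunE mulrDl.
Qed.

Lemma graph_formDr s t1 t2 :
  graph_form s (t1 + t2) = graph_form s t1 + graph_form s t2.
Proof.
by rewrite -big_split; apply: eq_bigr => q _; rewrite dotDr mulrDr.
Qed.

(** A nonzero entry of m joins opposite sides, so expanding both sums gives the same terms, up to
    the symmetry of m. *)
Lemma graph_form_transpose s t :
  graph_form s t = \sum_(q | ~~ side q) t q * dot (m q) s.
Proof.
rewrite /graph_form /dot.
under eq_bigr do rewrite mulr_sumr.
under [RHS]eq_bigr do rewrite mulr_sumr.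
rewrite [RHS]exchange_big /= big_mkcond; apply: eq_bigr => q _.
case: (boolP (side q)) => sq; last first.
  rewrite big1 // => q' /negPf sq'.
  by rewrite m_bip ?mul0r ?mulr0 // sq' (negPf sq).
rewrite (bigID (fun q' => side q')) /= big1 ?add0r => [|q' sq'].
  by apply: eq_bigr => q' _; rewrite (m_sym q'); ring.
by rewrite m_bip ?mul0r ?mulr0 // sq sq'.
Qed.

(** After transposition the two halves run over complementary sides and add up to a full sum, in
    which only q survives. *)
Lemma graph_form_unit q s :
  graph_form (unit_cfg q) s + graph_form s (unit_cfg q) = dot (m q) s.
Proof.
rewrite (graph_form_transpose s) -[RHS]mul1r.
rewrite (_ : _ + _ = \sum_q' unit_cfg q q' * dot (m q') s); last first.
  by rewrite [RHS](bigID side).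
rewrite (bigD1 q) //= ffunE eqxx big1 ?addr0 // => q' /negPf q'q.
by rewrite ffunE q'q mul0r.
Qed.

Lemma graph_form_ortho tau s :
  (forall q, dot (m q) tau = 0) -> graph_form s tau = 0.
Proof. by move=> mtau; rewrite /graph_form big1 // => q _; rewrite mtau mulr0. Qed.

Lemma graph_form_ortho_l tau s :
  (forall q, dot (m q) tau = 0) -> graph_form tau s = 0.
Proof.
move=> mtau; rewrite graph_form_transpose big1 // => q _.
by rewrite mtau mulr0.
Qed.

(** Turns stabilization into a first-order recursion in direction q. *)
Lemma graph_gen_wave q g :
  (graph_gen q *m wave g = wave g) <->
  forall s, g (s + unit_cfg q) = omegaX (theta q - dot (m q) s) * g s.
Proof.
rewrite /graph_gen -scalemxAl weyl_wave scale_wave.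
split=> [/wave_inj gq s|gq].
  by rewrite -gq addrK mulrA -omegaXD.
apply: eq_wave => s.
by rewrite mulrA -omegaXD -gq subrK.
Qed.

Lemma graph_state_stab q : graph_gen q *m graph_state = graph_state.
Proof.
apply/graph_gen_wave => s; rewrite -omegaXD; congr omegaX.
rewrite -(graph_form_unit q s) dotDr dot_unitr.
rewrite graph_formDl !graph_formDr.
(* The second-order term of the increment is m q q, up to the choice of side, and bipartiteness
   kills it. *)
rewrite (_ : graph_form (unit_cfg q) (unit_cfg q) = 0); first by ring.
rewrite /graph_form big1 // => q' _; rewrite dot_unitr ffunE.
by have [->|_] := eqVneq q' q; rewrite ?mul0r // m_bip ?mulr0.
Qed.

Lemma graph_state_unique phi :
  (forall q, graph_gen q *m phi = phi) -> exists a, phi = a *: graph_state.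
Proof.
have [g ->] := waveP phi => stab.
pose psi s := omegaX (dot theta s - graph_form s s).
have psiP q s : psi (s + unit_cfg q) = omegaX (theta q - dot (m q) s) * psi s.
  by have /graph_gen_wave := graph_state_stab q; apply.
have gP q s : g (s + unit_cfg q) = omegaX (theta q - dot (m q) s) * g s.
  by have /graph_gen_wave := stab q; apply.
(* The quotient g / psi is invariant under translation by u, in cross-multiplied form. Unit
   configurations generate all translations, so the quotient is constant. *)
pose per u := forall s, g (s + u) * psi s = g s * psi (s + u).
have per0 : per 0 by move=> s; rewrite addr0.
have psi_neq0 s : psi s != 0 by exact: omegaX_neq0.
have perD u v : per u -> per v -> per (u + v).
  move=> pu pv s; apply: (mulIf (psi_neq0 (s + u))).
  rewrite addrA mulrAC pv -mulrA [psi _ * psi s]mulrC mulrA pu; ring.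
have per_unit q : per (unit_cfg q).
  by move=> s; rewrite psiP gP; ring.
have perT u : per u.
  rewrite (cfg_sum_unit u); apply: (big_ind per) => // q _.
  elim: (nat_of_ord _) => [|n IHn]; first by rewrite mulr0n.
  by rewrite mulrS; apply: perD.
exists (g 0 / psi 0); rewrite scale_wave; apply: eq_wave => s.
apply: (mulIf (psi_neq0 0)); have := perT s 0; rewrite add0r => ->.
by rewrite mulrAC divfK.
Qed.

Lemma graph_state_neq0 : graph_state != 0.
Proof.
apply/eqP => /colP /(_ (enum_rank (0 : cfg))); rewrite !mxE => /eqP.
by rewrite (negPf (omegaX_neq0 _)).
Qed.

Lemma graph_state_symmetry tau :
  (forall q, dot (m q) tau = 0) ->
  weyl tau 0 *m graph_state = omegaX (- dot theta tau) *: graph_state.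
Proof.
move=> mtau; rewrite weyl_wave scale_wave; apply: eq_wave => s.
rewrite -!omegaXD; congr omegaX.
have mNtau q : dot (m q) (- tau) = 0 by rewrite dotNr mtau oppr0.
rewrite dot0l graph_formDl !graph_formDr !(graph_form_ortho _ mNtau).
rewrite (graph_form_ortho_l _ mNtau) dotBr; ring.
Qed.

End GraphState.
End Configurations.
End WeylOperators.

(** * Powers with exponents modulo L, and circulant matrices *)

Section PeriodicPowers.
Set Implicit Arguments.
Unset Strict Implicit.
Unset Printing Implicit Defensive.

Lemma ZpE L (k : 'Z_L) : k = (k : nat)%:R.
Proof. by rewrite natr_Zp. Qed.

Section Powers.
Variables (A : unitRingType) (L : nat) (x : A).
Hypothesis L_gt1 : (1 < L)%N.
Hypothesis x_exp : x ^+ L = 1.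

Definition zpow (k : 'Z_L) : A := x ^+ (k : nat).

Lemma zpow_nat n : zpow n%:R = x ^+ n.
Proof. by rewrite /zpow val_Zp_nat // expr_mod. Qed.

Lemma zpow0 : zpow 0 = 1. Proof. exact: expr0. Qed.

Lemma zpow1 : zpow 1 = x. Proof. by rewrite -[1]/(1%:R) zpow_nat expr1. Qed.

Lemma zpowD k l : zpow (k + l) = zpow k * zpow l.
Proof. by rewrite -exprD (ZpE k) (ZpE l) -natrD zpow_nat -!ZpE. Qed.

Lemma zpowNK k : zpow (- k) * zpow k = 1.
Proof. by rewrite -zpowD addNr zpow0. Qed.

Lemma zpowKN k : zpow k * zpow (- k) = 1.
Proof. by rewrite -zpowD subrr zpow0. Qed.

(** From x^L = 1 it follows that x is invertible, so negative powers too depend only on the exponent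
    modulo L. *)
Lemma zpow_int (k : int) : x ^ k = zpow k%:~R.
Proof.
case: k => n; first by rewrite -pmulrn zpow_nat.
have ux : zpow (n.+1)%:R \is a GRing.unit.
  by apply/unitrP; exists (zpow (- n.+1%:R)); rewrite zpowNK zpowKN.
apply: (mulIr ux); rewrite [in X in _ = X]NegzE mulrNz -pmulrn zpowNK.
by rewrite zpow_nat /= mulVr // -zpow_nat.
Qed.

End Powers.

Lemma trmx_exp (K : comPzRingType) n (M : 'M[K]_n) k : (M ^+ k)^T = M^T ^+ k.
Proof.
elim: k => [|k IHk]; first by rewrite !expr0 trmx1.
by rewrite exprSr exprS -IHk -!mulmxE trmx_mul.
Qed.

Section Circulant.
Variables (p L : nat).
Hypothesis L_gt1 : (1 < L)%N.
Variables (c : int -> 'F_p) (ka kb : int).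

(** Multiplication by x in the monomial basis of F_p[x]/(x^L - 1). *)
Definition cyclic_shift : 'M['F_p]_(Zdim L) :=
  \matrix_(i' < Zdim L, i < Zdim L) ((i' : 'Z_L) == (i : 'Z_L) + 1)%:R.

Lemma cyclic_shift_exp n :
  cyclic_shift ^+ n =
  \matrix_(i' < Zdim L, i < Zdim L) ((i' : 'Z_L) == (i : 'Z_L) + n%:R)%:R.
Proof.
elim: n => [|n IHn].
  by apply/matrixP => i' i; rewrite expr0 !mxE addr0.
apply/matrixP => i' i; rewrite exprSr IHn -mulmxE !mxE.
rewrite (bigD1 ((i : 'Z_L) + 1)) //= !mxE eqxx mulr1 big1 ?addr0.
  by rewrite mulrS addrA.
by move=> k /negPf k_neq; rewrite !mxE k_neq mulr0.
Qed.

Lemma cyclic_shift_period : cyclic_shift ^+ L = 1.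
Proof.
rewrite cyclic_shift_exp; apply/matrixP => i' i.
by rewrite !mxE pchar_Zp // addr0.
Qed.

(** Exponents are replaced by their representatives in [0, L), so that f becomes an ordinary
    polynomial. *)
Let g : {poly 'F_p} :=
  \sum_(k <- zrange ka kb) c k *: 'X^(k%:~R : 'Z_L).

Lemma circulantF_horner : circulantF L c ka kb = horner_mx cyclic_shift g.
Proof.
rewrite linear_sum /=; apply/matrixP => i' i.
rewrite mxE summxE big_mkcond; apply: eq_bigr => k _.
rewrite linearZ rmorphXn /= horner_mx_X cyclic_shift_exp !mxE natr_Zp.
rewrite eq_sym subr_eq [_ + (i : 'Z_L)]addrC.
by case: eqP; rewrite ?mulr1 ?mulr0.
Qed.

Local Notation h := ('X^L - 1 : {poly 'F_p}).

(** The quotient ring reduces modulo [mk_monic h], which takes a default value unless h is monic and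
    nonconstant. *)
Lemma mk_monic_cyclic : mk_monic h = h.
Proof.
have L_gt0 : (0 < L)%N by apply: ltnW.
by rewrite /mk_monic size_XnsubC // ltnS L_gt0 monicXnsubC.
Qed.

Lemma in_qpolyX : in_qpoly h 'X = 'qX.
Proof. by []. Qed.

Lemma qpolyX_period : 'qX ^+ L = 1 :> {poly %/ h}.
Proof.
rewrite -in_qpolyX -rmorphXn -(in_qpoly1 h); apply/eqP.
rewrite -subr_eq0 -rmorphB; apply/eqP/val_inj => /=.
rewrite mk_monic_cyclic Pdiv.RingMonic.rmodpp //.
by rewrite monicXnsubC // ltnW.
Qed.

Lemma laurent_eval_qpolyX :
  laurent_eval c ka kb ('qX : {poly %/ h}) = in_qpoly h g.
Proof.
rewrite linear_sum; apply: eq_bigr => k _.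
by rewrite linearZ rmorphXn /= in_qpolyX (zpow_int L_gt1 qpolyX_period).
Qed.

(** The relation says that g^n leaves remainder 1 modulo h; evaluating the division at the cyclic
    shift, a root of h, carries it over to matrices. *)
Lemma circulantF_exp n :
  laurent_eval c ka kb ('qX : {poly %/ h}) ^+ n = 1 ->
  circulantF L c ka kb ^+ n = 1.
Proof.
rewrite laurent_eval_qpolyX circulantF_horner -!rmorphXn /= => gn1.
have h_monic : h \is monic by rewrite monicXnsubC // ltnW.
have -> : g ^+ n = Pdiv.Ring.rdivp (g ^+ n) h * h + 1.
  rewrite {1}(Pdiv.RingMonic.rdivp_eq h_monic (g ^+ n)); congr (_ + _).
  have /(congr1 val) := gn1.
  by rewrite /= mk_monic_cyclic.
rewrite rmorphD rmorphM rmorphB rmorph1 rmorphXn /= horner_mx_X.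
by rewrite cyclic_shift_period subrr mulr0 add0r.
Qed.

End Circulant.
End PeriodicPowers.

(** * From rows of the lattice to configurations and Weyl operators *)

Section Lattice.
Set Implicit Arguments.
Unset Strict Implicit.
Unset Printing Implicit Defensive.

Variables (R : realType) (p : nat) (Lx Ly : nat).
Hypothesis p_prime : prime p.

Local Notation omegaX := (@omegaX R p).
Local Notation weyl := (@weyl R p (dof Lx Ly)).
Local Notation cfg := {ffun dof Lx Ly -> 'F_p}.
Local Notation vec := 'cV['F_p]_(Zdim Lx).
Local Notation mx := 'M['F_p]_(Zdim Lx).
Local Notation e := (@unitvec p Lx).

Lemma local_op_shiftX (q : dof Lx Ly) :
  local_op q (shiftX R p) = weyl (unit_cfg p q) 0 :> operator R p Lx Ly.
Proof.
apply/matrixP => s t; rewrite !mxE dot0l oppr0 omegaX0 /=.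
case: eqP => [->|neq].
  case: forallP => [_|[]]; first by rewrite mxE !ffunE !eqxx.
  by move=> q'; apply/implyP => /negPf q'q; rewrite !ffunE q'q addr0.
case: forallP => // eq_st; rewrite mxE; case: eqP => // eq_q.
case: neq; apply/ffunP => q'; rewrite !ffunE.
have [->|q'q] := eqVneq q' q; first by rewrite eq_q.
by have := eq_st q'; rewrite q'q addr0 => /eqP.
Qed.

Lemma local_op_clockZ (q : dof Lx Ly) :
  local_op q (clockZ R p) = weyl 0 (unit_cfg p q) :> operator R p Lx Ly.
Proof.
apply/matrixP => s t; rewrite !mxE dotC dot_unitr addr0 /=.
case: eqP => [->|neq].
  case: forallP => [_|[]]; first by rewrite !mxE eqxx.
  by move=> q'; apply/implyP.
case: forallP => // eq_st; rewrite !mxE; case: eqP => // eq_q.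
case: neq; apply/ffunP => q'.
have [->|q'q] := eqVneq q' q; first exact: eq_q.
by have := eq_st q'; rewrite q'q => /eqP.
Qed.

Definition sheet_cfg (al : species) (V : 'Z_Ly -> vec) : cfg :=
  [ffun q => if q.2 == al then V q.1.2 q.1.1 0 else 0].

Definition row_cfg (al : species) (j : 'Z_Ly) (v : vec) : cfg :=
  sheet_cfg al (fun j' => if j' == j then v else 0).

Lemma row_cfgE al j v (i' : 'Z_Lx) (j' : 'Z_Ly) al' :
  row_cfg al j v (i', j', al') =
  if (al' == al) && (j' == j) then v i' 0 else 0.
Proof. by rewrite ffunE /=; do 2!case: ifP => //=; rewrite mxE. Qed.

Lemma row_cfg_unit al j i : row_cfg al j (e i) = unit_cfg p (i, j, al).
Proof.
apply/ffunP => -[[i' j'] al']; rewrite row_cfgE !ffunE !xpair_eqE !mxE andbT.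
by case: (al' == al); case: (j' == j); rewrite ?andbF ?andbT.
Qed.

Lemma row_cfg_sum al j v :
  row_cfg al j v = \sum_(i : 'Z_Lx) unit_cfg p (i, j, al) *+ (v i 0%R : nat).
Proof.
apply/ffunP => -[[i' j'] al']; rewrite row_cfgE sum_ffunE (bigD1 i') //=.
rewrite [X in _ + X]big1 => [|i /negPf i'i].
  rewrite ffunMnE ffunE !xpair_eqE (eqxx i') [RHS]addr0 andbC.
  by case: (_ && _); rewrite ?natr_Zp ?mul0rn.
by rewrite ffunMnE ffunE !xpair_eqE eq_sym i'i mul0rn.
Qed.

Lemma sheet_cfg_sum al V :
  sheet_cfg al V = \sum_(j : 'Z_Ly) row_cfg al j (V j).
Proof.
apply/ffunP => -[[i' j'] al']; rewrite ffunE sum_ffunE (bigD1 j') //=.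
rewrite row_cfgE eqxx andbT big1 ?addr0 // => j /negPf jj'.
by rewrite row_cfgE [j' == j]eq_sym jj' andbF.
Qed.

(** Reduces every commutation phase of the model to a product of matrices over F_p. *)
Lemma dot_row_sheet al j v al' V :
  dot (row_cfg al j v) (sheet_cfg al' V) =
  if al == al' then (v^T *m V j) 0 0 else 0.
Proof.
rewrite row_cfg_sum dotC dot_sumr; case: ifP => [/eqP -> | al'al].
  rewrite mxE; apply: eq_bigr => i _; rewrite mxE dotMnr dot_unitr.
  by rewrite ffunE eqxx -mulr_natr natr_Zp mulrC.
rewrite big1 // => i _.
by rewrite dotMnr dot_unitr ffunE al'al mul0rn.
Qed.

Lemma Xrow_weyl al j v : Xrow R al j v = weyl (row_cfg al j v) 0.
Proof.
rewrite row_cfg_sum -weylX_prod //; apply: eq_bigr => i _.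
by rewrite local_op_shiftX weylX_exp.
Qed.

Lemma Zrow_weyl al j v : Zrow R al j v = weyl 0 (row_cfg al j v).
Proof.
rewrite row_cfg_sum -weylZ_prod //; apply: eq_bigr => i _.
by rewrite local_op_clockZ weylZ_exp.
Qed.

Lemma row_cfg2E al j1 v1 j2 v2 (i : 'Z_Lx) (j : 'Z_Ly) al' :
  (row_cfg al j1 v1 + row_cfg al j2 v2) (i, j, al') =
  if al' == al then
    (if j == j1 then v1 i 0 else 0) + (if j == j2 then v2 i 0 else 0)
  else 0.
Proof. by rewrite ffunE !row_cfgE; case: (al' == al); rewrite //= addr0. Qed.

Lemma dot_row2_sheet al j1 v1 j2 v2 al' V :
  dot (row_cfg al j1 v1 + row_cfg al j2 v2) (sheet_cfg al' V) =
  if al == al' then (v1^T *m V j1 + v2^T *m V j2) 0 0 else 0.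
Proof.
rewrite dotDl !dot_row_sheet; case: ifP => _; last by rewrite addr0.
by rewrite [RHS]mxE.
Qed.

(** * The weight matrix: bipartiteness, symmetry, and orthogonality to evolving sheets *)

Section Weights.
Variables (F : mx) (W : 'Z_Ly -> mx) (l : 'Z_Ly).
Hypothesis W_step : forall j, W (j + 1) *m F = F *m W j.

Definition weightA (i : 'Z_Lx) (j : 'Z_Ly) : cfg :=
  row_cfg spb (j + l) (- W j *m e i) + row_cfg spb (j + l + 1) (F *m W j *m e i).

Definition weightB (i : 'Z_Lx) (j : 'Z_Ly) : cfg :=
  row_cfg spa j (- (W j)^T *m e i) + row_cfg spa (j - 1) (F^T *m (W j)^T *m e i).

(* The generator with X part on site (i, j) of species b is B_{i,j-l}. *)
Definition weight (q : dof Lx Ly) : cfg :=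
  if q.2 then weightB q.1.1 (q.1.2 - l) else weightA q.1.1 q.1.2.

Lemma weight_spa i j : weight (i, j, spa) = weightA i j. Proof. by []. Qed.

Lemma weight_spb i j : weight (i, j + l, spb) = weightB i j.
Proof. by rewrite /weight /= addrK. Qed.

Lemma weight_bip (q q' : dof Lx Ly) : q.2 = q'.2 -> weight q q' = 0.
Proof.
case: q q' => [[i j] al] [[i' j'] al'] /= <-.
by rewrite /weight; case: al; rewrite [LHS]row_cfg2E.
Qed.

Lemma mul_unitvec n (M : 'M['F_p]_(n, Zdim Lx)) i k :
  (M *m e i) k 0 = M k i.
Proof. by rewrite -colE mxE. Qed.

(** A and B terms overlap when j' = j, where both sides are entries of - W_j, and when j' = j + 1,
    where they are entries of F W_j and W_{j+1} F. *)
Lemma weightA_weightB i j i' j' :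
  weightA i j (i', j' + l, spb) = weightB i' j' (i, j, spa).
Proof.
rewrite [LHS]row_cfg2E [RHS]row_cfg2E /= !mul_unitvec.
rewrite addrAC !(inj_eq (addIr _)).
rewrite [j == j']eq_sym [j == j' - 1]eq_sym subr_eq.
congr (_ + _); first by case: eqP => [->|//]; rewrite !mxE.
case: eqP => [->|//]; rewrite -W_step -trmx_mul.
by rewrite [RHS]mxE.
Qed.

Lemma weight_sym q q' : weight q q' = weight q' q.
Proof.
have sym_ab i j i' j' : weight (i, j, spa) (i', j', spb) =
    weight (i', j', spb) (i, j, spa).
  by have := weightA_weightB i j i' (j' - l); rewrite subrK.
case: q q' => [[i j] al] [[i' j'] al'].
have [al_eq|] := eqVneq al al'; first by rewrite !weight_bip.
by case: al al' => -[] // _; rewrite -sym_ab.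
Qed.

Lemma weightA_spa i j V : dot (weightA i j) (sheet_cfg spa V) = 0.
Proof. exact: dot_row2_sheet. Qed.

Lemma weightB_spb i j V : dot (weightB i j) (sheet_cfg spb V) = 0.
Proof. exact: dot_row2_sheet. Qed.

(** Factoring out W_j leaves the defect of V with respect to the evolution by F^T; [weightB_spa]
    does the same for F. *)
Lemma weightA_spb i j V :
  dot (weightA i j) (sheet_cfg spb V) =
  ((W j *m e i)^T *m (F^T *m V (j + l + 1) - V (j + l))) 0 0.
Proof.
rewrite [LHS]dot_row2_sheet /= mulmxBr mulmxA addrC.
by rewrite mulNmx linearN /= mulNmx -(mulmxA F) (trmx_mul F).
Qed.

Lemma weightB_spa i j V :
  dot (weightB i j) (sheet_cfg spa V) =
  (((W j)^T *m e i)^T *m (F *m V (j - 1) - V j)) 0 0.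
Proof.
rewrite [LHS]dot_row2_sheet /= mulmxBr mulmxA addrC.
by rewrite mulNmx linearN /= mulNmx -(mulmxA F^T) (trmx_mul F^T) trmxK.
Qed.

Lemma weight_sheet_spa q V :
  (forall j, F *m V j = V (j + 1)) -> dot (weight q) (sheet_cfg spa V) = 0.
Proof.
move=> FV; rewrite /weight; case: ifP => _; last exact: weightA_spa.
by rewrite weightB_spa FV subrK subrr mulmx0 mxE.
Qed.

Lemma weight_sheet_spb q V :
  (forall j, F^T *m V (j + 1) = V j) -> dot (weight q) (sheet_cfg spb V) = 0.
Proof.
move=> FV; rewrite /weight; case: ifP => _; first exact: weightB_spb.
by rewrite weightA_spb FV subrr mulmx0 mxE.
Qed.

End Weights.

(** * The Hamiltonian terms as graph-state generators, and the ground state *)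

Section Model.
Hypothesis Ly_gt1 : (1 < Ly)%N.
Variables (F W0 : mx) (ly : nat).
Hypothesis F_period : F ^+ Ly = 1.

Lemma FT_period : F^T ^+ Ly = 1.
Proof. by rewrite -trmx_exp F_period trmx1. Qed.

Local Notation Fz := (@zpow mx Ly F).
Local Notation FTz := (@zpow mx Ly F^T).

Lemma zrepK (j : 'Z_Ly) : (zrep j)%:~R = j.
Proof. by rewrite /zrep -pmulrn natr_Zp. Qed.

Definition conjW (j : 'Z_Ly) : mx := Wmx F W0 (zrep j).

Lemma conjWE j : conjW j = Fz j * W0 * Fz (- j).
Proof.
rewrite /conjW /Wmx !(zpow_int Ly_gt1 F_period) rmorphN /= zrepK.
by rewrite !mulmxE.
Qed.

Lemma conjW0 : conjW 0 = W0.
Proof. by rewrite conjWE oppr0 /zpow !expr0 mul1r mulr1. Qed.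

Lemma conjW_step j : conjW (j + 1) *m F = F *m conjW j.
Proof.
have F1 := zpow1 Ly_gt1 F_period.
have FzV : Fz (- (1 + j)) * F = Fz (- j).
  by rewrite -{2}F1 -zpowD //; congr zpow; rewrite opprD addrAC addNr add0r.
by rewrite !conjWE !mulmxE [j + 1]addrC -!mulrA FzV zpowD // F1 -!mulrA.
Qed.

Definition symA_cfg (j0 : 'Z_Ly) (v : vec) : cfg :=
  sheet_cfg spa (fun j => Fz (j - j0) *m v).

Definition symB_cfg (j0 : 'Z_Ly) (v : vec) : cfg :=
  sheet_cfg spb (fun j => FTz (j0 - j) *m v).

Lemma symA_weyl j0 v : symA R F j0 v = weyl (symA_cfg j0 v) 0.
Proof.
rewrite /symA_cfg sheet_cfg_sum -weylX_prod //; apply: eq_bigr => j _.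
by rewrite Xrow_weyl (zpow_int Ly_gt1 F_period) rmorphB /= !zrepK.
Qed.

Lemma symB_weyl j0 v : symB R F j0 v = weyl (symB_cfg j0 v) 0.
Proof.
rewrite /symB_cfg sheet_cfg_sum -weylX_prod //; apply: eq_bigr => j _.
by rewrite Xrow_weyl (zpow_int Ly_gt1 FT_period) rmorphB /= !zrepK.
Qed.

Local Notation wA := (weightA F conjW ly%:R).
Local Notation wB := (weightB F conjW).
Local Notation wgt := (weight F conjW ly%:R).

Lemma termA_weyl i (j : 'Z_Ly) :
  termA R F W0 ly i j = weyl (unit_cfg p (i, j, spa)) (wgt (i, j, spa)).
Proof.
by rewrite /termA !Xrow_weyl !Zrow_weyl row_cfg_unit weylXZ // weylM // dot0r
           oppr0 omegaX0 scale1r addr0.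
Qed.

Lemma termB_weyl i (j : 'Z_Ly) :
  termB R F W0 ly i j =
  weyl (unit_cfg p (i, j + ly%:R, spb)) (wgt (i, j + ly%:R, spb)).
Proof.
by rewrite weight_spb /termB !Xrow_weyl !Zrow_weyl row_cfg_unit weylXZ //
           weylM // dot0r oppr0 omegaX0 scale1r addr0.
Qed.

Lemma weight_symA q j0 v : dot (wgt q) (symA_cfg j0 v) = 0.
Proof.
apply: weight_sheet_spa => j; rewrite mulmxA; congr (_ *m v).
have F1 := zpow1 Ly_gt1 F_period.
by rewrite -[X in X *m _]F1 mulmxE -zpowD // addrA [1 + j]addrC.
Qed.

Lemma weight_symB q j0 v : dot (wgt q) (symB_cfg j0 v) = 0.
Proof.
apply: weight_sheet_spb => j; rewrite mulmxA; congr (_ *m v).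
have F1 := zpow1 Ly_gt1 FT_period.
rewrite -[X in X *m _]F1 mulmxE -zpowD ?FT_period //; congr zpow.
by rewrite addrCA; congr (j0 + _); rewrite opprD addrCA subrr addr0.
Qed.

Lemma wgt_sym q q' : wgt q q' = wgt q' q.
Proof. exact: weight_sym conjW_step _ _. Qed.

Lemma term_sym_comm i (j j0 : 'Z_Ly) v :
  [/\ GRing.comm (termA R F W0 ly i j) (symA R F j0 v),
      GRing.comm (termA R F W0 ly i j) (symB R F j0 v),
      GRing.comm (termB R F W0 ly i j) (symA R F j0 v)
    & GRing.comm (termB R F W0 ly i j) (symB R F j0 v)].
Proof.
have commA q : GRing.comm (weyl (unit_cfg p q) (wgt q)) (symA R F j0 v).
  by rewrite symA_weyl; apply: (weyl_comm _ p_prime); rewrite dot0l weight_symA.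
have commB q : GRing.comm (weyl (unit_cfg p q) (wgt q)) (symB R F j0 v).
  by rewrite symB_weyl; apply: (weyl_comm _ p_prime); rewrite dot0l weight_symB.
by rewrite termA_weyl termB_weyl; split.
Qed.

(** For two generators the symplectic form is a difference of transposed weights, so [wgt_sym]
    settles all three cases at once. *)
Lemma term_term_comm i (j : 'Z_Ly) i' (j' : 'Z_Ly) :
  [/\ GRing.comm (termA R F W0 ly i j) (termA R F W0 ly i' j'),
      GRing.comm (termA R F W0 ly i j) (termB R F W0 ly i' j')
    & GRing.comm (termB R F W0 ly i j) (termB R F W0 ly i' j')].
Proof.
have comm q q' : GRing.comm (weyl (unit_cfg p q) (wgt q))
                            (weyl (unit_cfg p q') (wgt q')).
  by apply: (weyl_comm _ p_prime); rewrite !dot_unitr wgt_sym.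
by rewrite !termA_weyl !termB_weyl; split.
Qed.

(** The shift by [ly] permutes the rows, so A and B together list each generator once. *)
Lemma gen_stabilized (A B : 'Z_Lx -> 'Z_Ly -> operator R p Lx Ly)
    (G : dof Lx Ly -> operator R p Lx Ly) psi :
  (forall i j, A i j = G (i, j, spa)) ->
  (forall i j, B i j = G (i, j + ly%:R, spb)) ->
  stabilized A B psi <-> forall q, G q *m psi = psi.
Proof.
move=> AG BG; split=> [AB [[i j] []]|Gq i j].
- by rewrite -[j](subrK ly%:R) -BG; case: (AB i (j - ly%:R)).
- by rewrite -AG; case: (AB i j).
- by rewrite AG BG.
Qed.

Lemma model_unique (theta : cfg) (A B : 'Z_Lx -> 'Z_Ly -> operator R p Lx Ly) :
  (forall i j, A i j = graph_gen R wgt theta (i, j, spa)) ->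
  (forall i j, B i j = graph_gen R wgt theta (i, j + ly%:R, spb)) ->
  unique_state (stabilized A B)
    (graph_state R (fun q : dof Lx Ly => q.2) wgt theta).
Proof.
move=> AG BG; split.
- exact: graph_state_neq0.
- apply/(gen_stabilized _ AG BG) => q.
  exact: graph_state_stab wgt_sym (@weight_bip _ _ _) _.
- move=> phi /(gen_stabilized _ AG BG).
  exact: graph_state_unique wgt_sym (@weight_bip _ _ _) _.
Qed.

Lemma model_symmetric theta tau :
  (forall q, dot (wgt q) tau = 0) ->
  weyl tau 0 *m graph_state R (fun q : dof Lx Ly => q.2) wgt theta =
  omegaX (- dot theta tau) *:
    graph_state R (fun q : dof Lx Ly => q.2) wgt theta.
Proof. exact: graph_state_symmetry wgt_sym (@weight_bip _ _ _) _. Qed.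

Lemma ground_state :
  exists psi : state R p Lx Ly,
    unique_state (stabilized (termA R F W0 ly (Ly := Ly))
                             (termB R F W0 ly (Ly := Ly))) psi /\
    forall (j0 : 'Z_Ly) v,
      symA R F j0 v *m psi = psi /\ symB R F j0 v *m psi = psi.
Proof.
exists (graph_state R (fun q : dof Lx Ly => q.2) wgt 0); split.
  by apply: model_unique => i j;
    rewrite ?termA_weyl ?termB_weyl /graph_gen ffunE omegaX0 scale1r.
move=> j0 v; rewrite symA_weyl symB_weyl.
have sym tau : (forall q, dot (wgt q) tau = 0) ->
    weyl tau 0 *m graph_state R (fun q : dof Lx Ly => q.2) wgt 0 =
    graph_state R (fun q : dof Lx Ly => q.2) wgt 0.
  by move=> /model_symmetric ->; rewrite dot0l oppr0 omegaX0 scale1r.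
by split; apply: sym => q; [exact: weight_symA | exact: weight_symB].
Qed.

(** * Conjugation by the truncated symmetry and the twist phase *)

Section Twist.
Variables (i : 'Z_Lx) (r : nat).
Hypothesis r_bound : (r + ly + 2 <= Ly)%N.

Definition trunc_col (j : 'Z_Ly) : vec :=
  if (j <= r)%N then F ^+ (j : nat) *m e i else 0.

Local Notation trunc_cfg := (sheet_cfg spa trunc_col).

Lemma truncS_weyl : truncS R Ly F i r = weyl trunc_cfg 0.
Proof.
rewrite /truncS; under eq_bigr do rewrite Xrow_weyl.
rewrite weylX_prod //; congr weyl; rewrite sheet_cfg_sum.
(* The truncated string does not wrap around, so its rows are distinct in ['Z_Ly]. *)
have le_r : (r.+1 <= Zdim Ly)%N by rewrite Zp_cast //; lia.
rewrite (big_ord_widen _ (fun k => row_cfg spa k%:R (F ^+ k *m e i)) le_r).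
rewrite big_mkcond; apply: eq_bigr => j _; rewrite ltnS natr_Zp /trunc_col.
case: ifP => // _; apply/ffunP => -[[i' j'] al].
by rewrite row_cfgE ffunE mxE if_same.
Qed.

(** Row -n is row Ly - n, which lies above r by [r_bound]: the far end of the string stays away from
    the cut. *)
Lemma trunc_col_neg n : (0 < n <= ly.+1)%N -> trunc_col (- n%:R) = 0.
Proof.
move=> /andP[n_gt0 n_le].
have -> : - n%:R = (Ly - n)%:R :> 'Z_Ly.
  by rewrite natrB ?pchar_Zp ?sub0r //; lia.
rewrite /trunc_col val_Zp_nat // modn_small; last by lia.
by rewrite leqNgt (_ : (r < Ly - n)%N) //; lia.
Qed.

(** B_{kj} sees the string only in rows j and j - 1. In the window both are empty unless j = 0,
    where row 0 carries e_i and row -1 is empty. *)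
Lemma twist_phase k (j : 'Z_Ly) :
  (if in_window (- ly%:Z) 0 j then dot (wB k j) trunc_cfg else 0) =
  if j == 0 then - W0 k i else 0.
Proof.
rewrite /in_window; case: hasP => [[d]|out]; last first.
  case: eqP => // j0; case: out; exists 0; last by rewrite j0.
  by rewrite mem_zrange lexx oppr_le0.
rewrite mem_zrange => /andP[d_ge d_le] /eqP <-{j}; rewrite weightB_spa.
have -> : d%:~R = - `|d|%N%:R :> 'Z_Ly.
  by rewrite pmulrn -mulrNz; congr _%:~R; lia.
have [->|d_neq0] := eqVneq `|d|%N 0%N.
  have colN1 : trunc_col (- 1) = 0 by exact: (@trunc_col_neg 1).
  rewrite oppr0 eqxx sub0r colN1 mulmx0 sub0r.
  rewrite /trunc_col /= mul1mx mulmxN mxE mul_unitvec conjW0 mxE.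
  by rewrite mul_unitvec mxE.
(* Row j - 1 can be as low as - (ly + 1), which is the extreme case of [trunc_col_neg]. *)
rewrite -opprD natr1 !trunc_col_neg; try by lia.
rewrite mulmx0 subrr mulmx0 mxE; case: eqP => // /eqP.
rewrite oppr_eq0 => /eqP /(congr1 val).
by rewrite /= val_Zp_nat // modn_small; lia.
Qed.

(** Supported on row [ly] because the X part of B_{k0} sits there. *)
Definition twist_charge : cfg := row_cfg spb ly%:R (- W0 *m e i).

Lemma twistA_gen k (j : 'Z_Ly) :
  twistA R F W0 ly i r k j = graph_gen R wgt twist_charge (k, j, spa).
Proof.
rewrite /graph_gen row_cfgE omegaX0 scale1r /twistA truncS_weyl termA_weyl.
rewrite weyl_conj // weight_spa weightA_spa omegaX0 scale1r.
by case: ifP.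
Qed.

Lemma twistB_gen k (j : 'Z_Ly) :
  twistB R F W0 ly i r k j =
  graph_gen R wgt twist_charge (k, j + ly%:R, spb).
Proof.
rewrite /graph_gen row_cfgE /= -subr_eq0 addrK mul_unitvec mxE -twist_phase.
rewrite /twistB truncS_weyl termB_weyl weyl_conj // weight_spb.
by case: ifP => // _; rewrite omegaX0 scale1r.
Qed.

Lemma twisted_ground_state (i' : 'Z_Lx) :
  exists psi' : state R p Lx Ly,
    unique_state (stabilized (twistA R F W0 ly i r (Ly := Ly))
                             (twistB R F W0 ly i r (Ly := Ly))) psi' /\
    symB R F (ly%:R : 'Z_Ly) (e i') *m psi' = omegaX (W0 i' i) *: psi'.
Proof.
exists (graph_state R (fun q : dof Lx Ly => q.2) wgt twist_charge); split.
  exact: model_unique twistA_gen twistB_gen.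
rewrite symB_weyl (model_symmetric _ (fun q => weight_symB q _ _)).
(* The symmetry based at row [ly] carries exactly e_{i'} on the only row where the charge lives. *)
rewrite dot_row_sheet /= subrr zpow0 mul1mx mul_unitvec mxE mul_unitvec.
by rewrite mxE opprK.
Qed.

End Twist.
End Model.
End Lattice.

Theorem mainTheorem4 (R : realType) (p : nat) (hp : prime p)
  (c : int -> 'F_p) (ka kb : int) (hk : ka < kb)
  (hka : c ka != 0) (hkb : c kb != 0)
  (hf1 : laurent_eval c ka kb (1 : ('F_p)^o) != 0)
  (N Lx Ly : nat) (hN : (1 <= N)%N) (hLx : Lx = (p ^ N)%N)
  (hLy0 : (0 < Ly)%N) (hLy : (Lx %| Ly)%N)
  (hf : laurent_eval c ka kb ('qX : {poly %/ ('X^Lx - 1 : {poly 'F_p})}) ^+ Ly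
        = 1)
  (lx ly : nat) (hly : (2 * ly + 2 <= Ly)%N)
  (F W0 : 'M['F_p]_(Zdim Lx)) (hF : F = circulantF Lx c ka kb)
  (hW : consistently_local F W0 ka kb lx ly) :
  let A := termA R F W0 ly (Ly := Ly) in
  let B := termB R F W0 ly (Ly := Ly) in
  let Sa := symA R F (Ly := Ly) in
  let Sb := symB R F (Ly := Ly) in
  [/\ forall i j j0 v,
        [/\ GRing.comm (A i j) (Sa j0 v), GRing.comm (A i j) (Sb j0 v),
            GRing.comm (B i j) (Sa j0 v) & GRing.comm (B i j) (Sb j0 v)],
      forall i j i' j',
        [/\ GRing.comm (A i j) (A i' j'), GRing.comm (A i j) (B i' j')
          & GRing.comm (B i j) (B i' j')],
      exists psi : state R p Lx Ly,
        unique_state (stabilized A B) psi /\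
        forall j0 v, Sa j0 v *m psi = psi /\ Sb j0 v *m psi = psi
    & forall (i i' : 'Z_Lx) (r : nat), (r + ly + 2 <= Ly)%N ->
        exists psi' : state R p Lx Ly,
          unique_state (stabilized (twistA R F W0 ly i r)
                                   (twistB R F W0 ly i r)) psi' /\
          Sb ly%:R (unitvec p i') *m psi' = omegaX R (W0 i' i) *: psi'].
Proof.
have Lx_gt1 : (1 < Lx)%N.
  by rewrite hLx -(exp1n N) ltn_exp2r // prime_gt1.
have Ly_gt1 : (1 < Ly)%N by lia.
have F_period : F ^+ Ly = 1 by rewrite hF; apply: circulantF_exp.
split.
- move=> i j j0 v; exact: term_sym_comm.
- move=> i j i' j'; exact: term_term_comm.
- exact: ground_state.
- move=> i i' r r_bound; exact: twisted_ground_state.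
Qed.
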